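(* Let $q$ be a mode and $k\ge2$. With $\mathbb{A}^q_k$ the matrix defined in the context, let $$\delta^q_{r,k}=\max\Big\{\|\mathbb{A}^q_kt_k\|_2 : t_k=\begin{bmatrix}\tilde x_0^\top&w_0^\top&\cdots&w_{k-1}^\top&v_0^\top&\cdots&v_k^\top\end{bmatrix}^\top,\ \|\tilde x_0\|_2\le\delta^x_0,\ \|w_i\|_2\le\eta_w\ (0\le i\le k-1),\ \|v_j\|_2\le\eta_v\ (0\le j\le k)\Big\},$$ where $\tilde x_0,w_i\in\mathbb{R}^n$ and $v_j\in\mathbb{R}^l$. Let $\hat\delta^q_{r,k}=\min\{\delta^{q,inf}_{r,k},\delta^{q,tri}_{r,k}\}$, where $$\begin{aligned}\delta^{q,tri}_{r,k}={}&\delta^x_0\|C^q_2\overline A^q(A^q_e)^{k-1}\|_2+\eta_w\|C^q_2\overline A^q(A^q_e)^{k-2}B^q_{e,w}\|_2\\&+\sum_{i=1}^{k-2}\big[\eta_w\|C^q_2\overline A^q(A^q_e)^iB^q_{e,w}\|_2+\eta_v\|C^q_2\overline A^q(A^q_e)^i(B^q_{e,v_1}+A^q_eB^q_{e,v_2})\|_2\big]\\&+\eta_v\big(\|C^q_2\overline A^q(A^q_e)^{k-2}B^q_{e,v_1}\|_2+\|C^q_2(B^{\star,q}_{e,v_1}+\overline A^qB^q_{e,v_2})\|_2+\|C^q_2B^{\star,q}_{e,v_2}+T^q_2\|_2\big)+\eta_w\|C^q_2B^{\star,q}_{e,w}\|_2\end{aligned}$$ and $\delta^{q,inf}_{r,k}=\|\mathbb{A}^q_kt^\star_k\|_2$,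 where $t^\star_k$ is a vertex maximizing $\|\mathbb{A}^q_kt\|_2$ among the vertices of the hypercube $\mathcal{X}^q_k\subset\mathbb{R}^{(n+l)(k+1)}$ consisting of all $x$ with $|x(i)|\le\delta^x_0$ for $1\le i\le n$, $|x(i)|\le\eta_w$ for $n+1\le i\le n(k+1)$, and $|x(i)|\le\eta_v$ for $n(k+1)+1\le i\le(n+l)(k+1)$. Then $\hat\delta^q_{r,k}$ is an over-approximation of $\delta^q_{r,k}$, i.e. $\delta^q_{r,k}\le\hat\delta^q_{r,k}$.
   Context: Given are real matrices $A\in\mathbb{R}^{n\times n}$, $C\in\mathbb{R}^{l\times n}$, $G^q\in\mathbb{R}^{n\times p}$, $H^q\in\mathbb{R}^{l\times p}$ and nonnegative constants $\delta^x_0,\eta_w,\eta_v$ (bounds on the initial state estimation error, process noise and measurement noise). Take a singular value decomposition $H^q=\begin{bmatrix}U^q_1&U^q_2\end{bmatrix}\begin{bmatrix}\Sigma^q&0\\0&0\end{bmatrix}\begin{bmatrix}V_1^{q\top}\\ V_2^{q\top}\end{bmatrix}$ with $\Sigma^q$ invertible, and for $i=1,2$ put $T^q_i=U_i^{q\top}$, $C^q_i=T^q_iC$, $G^q_i=G^qV^q_i$. The matrices $M^q_1$, $M^q_2$, $\tilde L^q$ are observer gains of compatible size with $M^q_1\Sigma^q=I$, $M^q_2C^q_2G^q_2=I$. Define $\overline A^q=(I-G^q_2M^q_2C^q_2)(A-G^q_1M^q_1C^q_1)$, $A^q_e=(I-\tilde L^qC^q_2)\overline A^q$, $B^{\star,q}_{e,w}=I-G^q_2M^q_2C^q_2$,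 $B^{\star,q}_{e,v_1}=-(I-G^q_2M^q_2C^q_2)G^q_1M^q_1T^q_1$, $B^{\star,q}_{e,v_2}=-G^q_2M^q_2T^q_2$, $B^q_{e,w}=(I-\tilde L^qC^q_2)B^{\star,q}_{e,w}$, $B^q_{e,v_1}=(I-\tilde L^qC^q_2)B^{\star,q}_{e,v_1}$, $B^q_{e,v_2}=(I-\tilde L^qC^q_2)B^{\star,q}_{e,v_2}-\tilde L^qT^q_2$. The block matrix $\mathbb{A}^q_k$ is $[\,C^q_2\overline A^q(A^q_e)^{k-1}\,|\,\mathsf W_0\,|\cdots|\,\mathsf W_{k-1}\,|\,\mathsf V_0\,|\cdots|\,\mathsf V_k\,]$ with $(n+l)(k+1)$ columns, where $\mathsf W_0=C^q_2\overline A^q(A^q_e)^{k-2}B^q_{e,w}$, $\mathsf W_i=C^q_2\overline A^q(A^q_e)^{k-1-i}B^q_{e,w}$ for $1\le i\le k-2$, $\mathsf W_{k-1}=C^q_2B^{\star,q}_{e,w}$, $\mathsf V_0=C^q_2\overline A^q(A^q_e)^{k-2}B^q_{e,v_1}$, $\mathsf V_i=C^q_2\overline A^q(A^q_e)^{k-1-i}(B^q_{e,v_1}+A^q_eB^q_{e,v_2})$ for $1\le i\le k-2$, $\mathsf V_{k-1}=C^q_2(B^{\star,q}_{e,v_1}+\overline A^qB^q_{e,v_2})$, $\mathsf V_k=C^q_2B^{\star,q}_{e,v_2}+T^q_2$. $\|\cdot\|_2$ denotes the Euclidean norm and the induced matrix 2-norm. *)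

(* Defs.v *)
From HB Require Import structures.
From mathcomp Require Import all_boot all_order all_algebra.
From mathcomp Require Import all_classical all_reals all_analysis.
From mathcomp Require Import lra.

Set Implicit Arguments.
Unset Strict Implicit.
Unset Printing Implicit Defensive.

Import Order.TTheory GRing.Theory Num.Theory.
Import numFieldNormedType.Exports.

Local Open Scope classical_set_scope.
Local Open Scope ring_scope.

(* The library norm `|x| on matrices is the max-entry norm, hence a separate
   Euclidean norm and its induced matrix norm. *)
Definition norm2 (R : realType) (m : nat) (x : 'cV[R]_m) : R :=
  Num.sqrt (\sum_(i < m) x i 0 ^+ 2).

Definition mxnorm2 (R : realType) (m n : nat) (M : 'M[R]_(m, n)) : R :=
  sup [set norm2 (M *m x) | x in [set x : 'cV[R]_n | norm2 x <= 1]].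

(* Two-sided, so that m = n is forced even though the type does not say so. *)
Definition orthogonal_mx (R : realType) (m n : nat) (Q : 'M[R]_(m, n)) : Prop :=
  Q^T *m Q = 1%:M /\ Q *m Q^T = 1%:M.

(* Full singular value decomposition in block form
     H = [U1 U2] [S 0; 0 0] [V1 V2]^T.
   Orthogonality of the outer factors forces l = r + l2 and p = r + p2. *)
Definition is_svd (R : realType) (l p r l2 p2 : nat) (H : 'M[R]_(l, p))
    (U1 : 'M[R]_(l, r)) (U2 : 'M[R]_(l, l2)) (S : 'M[R]_r)
    (V1 : 'M[R]_(p, r)) (V2 : 'M[R]_(p, p2)) : Prop :=
  [/\ orthogonal_mx (row_mx U1 U2),
      orthogonal_mx (row_mx V1 V2),
      is_diag_mx S,
      forall i, 0 <= S i i
    & H = row_mx U1 U2 *m block_mx S 0 0 0 *m col_mx V1^T V2^T].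

(* Dimension of t_k = (x0, w_0, ..., w_{k-1}, v_0, ..., v_k), in the shape
   produced by the block constructors; see dim_tE. *)
Definition dim_t (n l k : nat) : nat :=
  (n + \sum_(i < k) n + \sum_(j < k.+1) l)%N.

Lemma dim_tE n l k : dim_t n l k = ((n + l) * k.+1)%N.
Proof. by rewrite /dim_t !sum_nat_const !card_ord mulnDl -mulSn !(mulnC k.+1). Qed.

Definition tvec (R : realType) (n l k : nat) (x0 : 'cV[R]_n)
    (w : 'I_k -> 'cV[R]_n) (v : 'I_k.+1 -> 'cV[R]_l) : 'cV[R]_(dim_t n l k) :=
  col_mx (col_mx x0 (\mxcol_(i < k) w i)) (\mxcol_(j < k.+1) v j).

(* [ X | W 0 | ... | W (k-1) | V 0 | ... | V k ] *)
Definition block_row (R : realType) (m n l k : nat) (X : 'M[R]_(m, n))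
    (W : nat -> 'M[R]_(m, n)) (V : nat -> 'M[R]_(m, l)) :
    'M[R]_(m, dim_t n l k) :=
  row_mx (row_mx X (\mxrow_(i < k) W i)) (\mxrow_(j < k.+1) V j).

Definition residual_norms (R : realType) (m n l k : nat)
    (M : 'M[R]_(m, dim_t n l k)) (dx ew ev : R) : set R :=
  [set d | exists x0 (w : 'I_k -> 'cV[R]_n) (v : 'I_k.+1 -> 'cV[R]_l),
    [/\ norm2 x0 <= dx, (forall i, norm2 (w i) <= ew),
        (forall j, norm2 (v j) <= ev) & d = norm2 (M *m tvec x0 w v)]].

(* The supremum is attained; see delta_r_max. *)
Definition delta_r (R : realType) (m n l k : nat)
    (M : 'M[R]_(m, dim_t n l k)) (dx ew ev : R) : R :=
  sup (residual_norms M dx ew ev).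

Definition hypercube (R : realType) (n l k : nat) (dx ew ev : R) :
    set 'cV[R]_(dim_t n l k) :=
  [set x | forall i : 'I_(dim_t n l k),
    `|x i 0| <= if (i < n)%N then dx else
                if (i < n * k.+1)%N then ew else ev].
Arguments hypercube {R} n l k dx ew ev _.

(* Vertices of a polytope are its extreme points. *)
Definition is_vertex (R : realType) (N : nat) (X : set 'cV[R]_N)
    (x : 'cV[R]_N) : Prop :=
  X x /\ forall (y z : 'cV[R]_N) (a : R), X y -> X z -> 0 < a < 1 ->
    x = a *: y + (1 - a) *: z -> y = x /\ z = x.

Definition is_max_vertex (R : realType) (m N : nat) (M : 'M[R]_(m, N))
    (X : set 'cV[R]_N) (t : 'cV[R]_N) : Prop :=
  is_vertex X t /\ forall s, is_vertex X s -> norm2 (M *m s) <= norm2 (M *m t).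

(* Well-definedness: the maximum defining delta_r exists, and so does a
   maximizing vertex of the hypercube. *)

Lemma sum_continuous (R : realType) (T : topologicalType) m
    (f : 'I_m -> T -> R) :
  (forall i, continuous (f i)) -> continuous (fun t => \sum_(i < m) f i t).
Proof.
move=> cf; apply: continuous_big => // -[x y].
by apply: cvgD; [exact: cvg_fst | exact: cvg_snd].
Qed.

Lemma norm2_continuous (R : realType) (T : topologicalType) m
    (f : T -> 'cV[R]_m) :
  (forall i, continuous (fun t => f t i 0)) -> continuous (fun t => norm2 (f t)).
Proof.
move=> cf t; rewrite /norm2.
apply: (@continuous_comp _ _ _ (fun t => \sum_(i < m) f t i 0 ^+ 2) (@Num.sqrt R)).
  apply: sum_continuous => i {}t.
  by under eq_fun do rewrite expr2; apply: cvgM; exact: cf.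
exact: sqrt_continuous.
Qed.

Lemma entry_le_norm2 (R : realType) m (x : 'cV[R]_m) i : `|x i 0| <= norm2 x.
Proof.
rewrite -sqrtr_sqr ler_wsqrtr// (bigD1 i)//= lerDl.
by apply: sumr_ge0 => j _; exact: sqr_ge0.
Qed.

Lemma norm2_0 (R : realType) m : norm2 (0 : 'cV[R]_m) = 0.
Proof. by rewrite /norm2 big1 ?sqrtr0// => i _; rewrite mxE expr0n. Qed.

Lemma delta_r_max (R : realType) (m n l k : nat)
    (M : 'M[R]_(m, dim_t n l k)) (dx ew ev : R) :
  0 <= dx -> 0 <= ew -> 0 <= ev ->
  residual_norms M dx ew ev (delta_r M dx ew ev) /\
  ubound (residual_norms M dx ew ev) (delta_r M dx ew ev).
Proof.
move=> dx0 ew0 ev0.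
pose px (t : 'rV[R]_(dim_t n l k)) : 'cV[R]_n := usubmx (usubmx t^T).
pose pw i (t : 'rV[R]_(dim_t n l k)) : 'cV[R]_n :=
  submxcol (dsubmx (usubmx t^T)) i.
pose pv j (t : 'rV[R]_(dim_t n l k)) : 'cV[R]_l := submxcol (dsubmx t^T) j.
pose K := [set t : 'rV[R]_(dim_t n l k) | [/\ norm2 (px t) <= dx,
  forall i, norm2 (pw i t) <= ew & forall j, norm2 (pv j t) <= ev]].
have tE t : t^T = tvec (px t) (pw^~ t) (pv^~ t).
  by rewrite /tvec !submxcolK !vsubmxK.
have cpx : continuous (fun t => norm2 (px t)).
  apply: norm2_continuous => i; rewrite /px.
  by under eq_fun do rewrite !mxE; exact: coord_continuous.
have cpw i : continuous (fun t => norm2 (pw i t)).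
  apply: norm2_continuous => j; rewrite /pw.
  by under eq_fun do rewrite !mxE; exact: coord_continuous.
have cpv i : continuous (fun t => norm2 (pv i t)).
  apply: norm2_continuous => j; rewrite /pv.
  by under eq_fun do rewrite !mxE; exact: coord_continuous.
have clle (f : 'rV[R]_(dim_t n l k) -> R) c :
    continuous f -> closed [set t | f t <= c].
  move=> cf; apply: (@preimage_closed _ _ f [set x | x <= c]).
    by move=> t _; exact: cf.
  exact: closed_le.
have Kcl : closed K.
  rewrite (_ : K = [set t | norm2 (px t) <= dx] `&`
     (\bigcap_i [set t | norm2 (pw i t) <= ew] `&`
      \bigcap_j [set t | norm2 (pv j t) <= ev])); last first.
    apply/seteqP; split => t /=; first by case=> *; split => //; split => i _ /=.
    by case=> ? [h1 h2]; split => // i; [exact: h1 | exact: h2].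
  apply: closedI; first exact: clle.
  apply: closedI; apply: closed_bigI => i _; exact: clle.
have Kco : compact K.
  pose B := dx + ew + ev.
  have Bco : compact [set v : 'rV[R]_(dim_t n l k) |
      forall i, `[- B, B]%classic (v ord0 i)].
    by apply: (@rV_compact _ _ (fun=> `[- B, B]%classic)) => _; exact: segment_compact.
  apply: (subclosed_compact Kcl Bco) => t [tx tw tv] i /=.
  have -> : t ord0 i = t^T i 0 by rewrite mxE.
  rewrite in_itv/= -ler_norml tE /tvec.
  have hB m' (y : 'cV[R]_m') c j : norm2 y <= c -> c <= B -> `|y j 0| <= B.
    by move=> yc cB; exact: le_trans (entry_le_norm2 y j) (le_trans yc cB).
  have [dB wB vB] : [/\ dx <= B, ew <= B & ev <= B] by rewrite /B; split; lra.
  rewrite -[i]fintype.splitK; case: (fintype.split i) => j /=; last first.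
    by rewrite col_mxEd mxE; apply: hB vB.
  rewrite col_mxEu -[j]fintype.splitK; case: (fintype.split j) => j' /=.
    by rewrite col_mxEu; apply: hB dB.
  by rewrite col_mxEd mxE; apply: hB wB.
have K0 : K !=set0.
  exists 0; rewrite /K/= /px /pw /pv trmx0 !linear0 norm2_0.
  have sub0 (q s : nat) (i : 'I_s) : norm2 (submxcol (0 : 'cV[R]_(\sum_(_ < s) q)) i) = 0.
    by rewrite (_ : submxcol _ i = 0) ?norm2_0//; apply/matrixP => a c; rewrite !mxE.
  by split=> // i; rewrite sub0.
have cf : continuous (fun t : 'rV[R]_(dim_t n l k) => norm2 (M *m t^T)).
  apply: norm2_continuous => i; under eq_fun do rewrite mxE.
  apply: sum_continuous => j t; apply: (@cvgMl_tmp _ _ (nbhs t)).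
  rewrite mxE (_ : (fun t : 'rV[R]_(dim_t n l k) => t^T j 0) = fun t => t 0 j).
    exact: coord_continuous.
  by apply/funext => u; rewrite mxE.
have [c cK cmax] := EVT_max_rV K0 Kco (continuous_subspaceT cf).
have cub : ubound (residual_norms M dx ew ev) (norm2 (M *m c^T)).
  move=> _ [x0 [w [v [hx hw hv ->]]]].
  have := cmax (tvec x0 w v)^T; rewrite trmxK; apply; rewrite inE /K/= /px /pw /pv.
  rewrite trmxK /tvec !(col_mxKu, col_mxKd); split=> // i.
    by rewrite mxcolK.
  by rewrite mxcolK.
have cin : residual_norms M dx ew ev (norm2 (M *m c^T)).
  move: cK; rewrite inE => -[hx hw hv].
  by exists (px c), (pw^~ c), (pv^~ c); rewrite -tE.
have -> // : delta_r M dx ew ev = norm2 (M *m c^T).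
apply/eqP; rewrite eq_le; apply/andP; split.
  by apply: ge_sup => //; exists (norm2 (M *m c^T)).
by apply: ub_le_sup => //; exists (norm2 (M *m c^T)).
Qed.

Lemma max_vertex_exists (R : realType) (m n l k : nat)
    (M : 'M[R]_(m, dim_t n l k)) (dx ew ev : R) :
  0 <= dx -> 0 <= ew -> 0 <= ev ->
  exists t, is_max_vertex M (hypercube n l k dx ew ev) t.
Proof.
move=> dx0 ew0 ev0.
pose b (i : 'I_(dim_t n l k)) := if (i < n)%N then dx else
                if (i < n * k.+1)%N then ew else ev.
have b0 i : 0 <= b i by rewrite /b; case: ifP => // _; case: ifP.
pose sg (f : {ffun 'I_(dim_t n l k) -> bool}) : 'cV[R]_(dim_t n l k) :=
  \col_i ((-1) ^+ f i * b i).
have sgv f : is_vertex (hypercube n l k dx ew ev) (sg f).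
  have hsg i : `|sg f i 0| = b i by rewrite mxE normrMsign ger0_norm.
  split=> [i|y z a yX zX /andP[a0 a1] e]; first by rewrite hsg.
  suff h i : y i 0 = sg f i 0 /\ z i 0 = sg f i 0.
    by split; apply/matrixP => i j; rewrite (ord1 j); case: (h i).
  have := yX i; have := zX i; rewrite -/(b i) !ler_norml => /andP[z1 z2] /andP[y1 y2].
  have := congr1 (fun x : 'cV[R]_(dim_t n l k) => x i 0) e.
  by rewrite !mxE; case: (f i) => /=; rewrite ?expr0 ?expr1 => ei; split; nra.
have vsg x : is_vertex (hypercube n l k dx ew ev) x -> exists f, x = sg f.
  move=> [xX xv].
  have xb i : `|x i 0| = b i.
    apply/eqP; rewrite eq_le (xX i)/= leNgt; apply/negP => lt.
    pose e := b i - `|x i 0|.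
    have e0 : 0 < e by rewrite subr_gt0.
    pose d : 'cV[R]_(dim_t n l k) := delta_mx i 0.
    have side (c : R) : `|c| = e -> hypercube n l k dx ew ev (x + c *: d).
      move=> ce j; rewrite -/(b j) !mxE eqxx andbT.
      case: eqP => [->|_]; last by rewrite mulr0 addr0; exact: xX.
      by rewrite mulr1 (le_trans (ler_normD _ _))// ce /e addrC subrK.
    have [] := xv (x + e *: d) (x + (- e) *: d) 2^-1.
    - by apply: side; rewrite gtr0_norm.
    - by apply: side; rewrite normrN gtr0_norm.
    - by apply/andP; split; lra.
    - by apply/matrixP => p q; rewrite !mxE; lra.
    move=> /(congr1 (fun x : 'cV[R]_(dim_t n l k) => x i 0)).
    by rewrite !mxE !eqxx mulr1 => h _; lra.
  exists [ffun i => x i 0 < 0]; apply/matrixP => i j; rewrite (ord1 j) mxE ffunE.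
  rewrite -xb; case: ltP => h /=.
    by rewrite expr1 mulN1r ltr0_norm ?opprK.
  by rewrite expr0 mul1r ger0_norm.
have [f _ fmax] := @Order.TotalTheory.arg_maxP _ R _ [ffun=> true] predT
  (fun f => norm2 (M *m sg f)) isT.
by exists (sg f); split => // s /vsg[g ->]; exact: fmax.
Qed.

(* Main.v *)
(* delta_r is attained at some admissible t = (x0, w, v). Splitting A_k t into
   blocks, the triangle inequality and the induced norm give the bound
   delta_tri; its sum runs over the blocks W_i, V_i in reverse order. Since
   Euclidean balls lie inside the boxes of the same radius, t is also a point
   of the hypercube, where the convex function norm2 (A_k x) is dominated by
   its value at some vertex; this gives the bound delta_inf. *)
Require Import Defs.
From mathcomp Require Import all_boot all_order all_algebra.
From mathcomp Require Import all_classical all_reals all_analysis.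
From mathcomp Require Import zify ring lra.

Set Implicit Arguments.
Unset Strict Implicit.
Unset Printing Implicit Defensive.

Import Order.TTheory GRing.Theory Num.Theory.

Local Open Scope ring_scope.

(** * The Euclidean norm *)

Lemma norm2_ge0 (R : realType) m (x : 'cV[R]_m) : 0 <= norm2 x.
Proof. exact: sqrtr_ge0. Qed.

Lemma sqr_norm2 (R : realType) m (x : 'cV[R]_m) :
  norm2 x ^+ 2 = \sum_(i < m) x i 0 ^+ 2.
Proof. by rewrite sqr_sqrtr// sumr_ge0// => i _; exact: sqr_ge0. Qed.

Lemma norm2_eq0 (R : realType) m (x : 'cV[R]_m) : norm2 x = 0 -> x = 0.
Proof.
move=> x0; apply/matrixP => i j; rewrite (ord1 j) mxE.
by apply/eqP; rewrite -normr_le0 -x0 entry_le_norm2.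
Qed.

(** Expanding the squares [(b * x i 0 - a * y i 0) ^+ 2] and summing gives [2 * (a * b)] times the
    gap [a * b - \sum_i x i 0 * y i 0], and [a * b] can be cancelled once it is positive. If [a] or
    [b] is 0, the vector itself vanishes. *)
Lemma cauchy_schwarz_norm2 (R : realType) m (x y : 'cV[R]_m) :
  \sum_(i < m) x i 0 * y i 0 <= norm2 x * norm2 y.
Proof.
set a := norm2 x; set b := norm2 y.
have [a0|a_neq0] := eqVneq a 0.
  by rewrite a0 mul0r big1// => i _; rewrite (norm2_eq0 a0) mxE mul0r.
have [b0|b_neq0] := eqVneq b 0.
  by rewrite b0 mulr0 big1// => i _; rewrite (norm2_eq0 b0) mxE mulr0.
have ab_gt0 : 0 < a * b by rewrite mulr_gt0// lt0r norm2_ge0 andbT.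
have : 0 <= \sum_(i < m) (b * x i 0 - a * y i 0) ^+ 2.
  by apply: sumr_ge0 => i _; exact: sqr_ge0.
have -> : \sum_(i < m) (b * x i 0 - a * y i 0) ^+ 2
    = 2 * (a * b) * (a * b - \sum_(i < m) x i 0 * y i 0).
  have sqrE i : (b * x i 0 - a * y i 0) ^+ 2 = b ^+ 2 * x i 0 ^+ 2
    + a ^+ 2 * y i 0 ^+ 2 - 2 * (a * b) * (x i 0 * y i 0) by ring.
  under eq_bigr => i _ do rewrite sqrE.
  rewrite sumrB big_split/= -!mulr_sumr -!sqr_norm2 -/a -/b; ring.
by rewrite pmulr_rge0 ?subr_ge0// mulr_gt0.
Qed.

Lemma norm2D (R : realType) m (x y : 'cV[R]_m) :
  norm2 (x + y) <= norm2 x + norm2 y.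
Proof.
rewrite -ler_sqr ?nnegrE ?addr_ge0 ?norm2_ge0// sqr_norm2 sqrrD !sqr_norm2.
under eq_bigr => i _ do rewrite mxE sqrrD.
rewrite 2!big_split/= lerD2r lerD2l sumrMnl lerMn2r/=.
exact: cauchy_schwarz_norm2.
Qed.

Lemma norm2Z (R : realType) m (a : R) (x : 'cV[R]_m) :
  norm2 (a *: x) = `|a| * norm2 x.
Proof.
rewrite /norm2; under eq_bigr => i _ do rewrite mxE exprMn.
by rewrite -mulr_sumr sqrtrM ?sqr_ge0// sqrtr_sqr.
Qed.

Lemma norm2_sum (R : realType) m (I : Type) (s : seq I) (P : pred I)
    (F : I -> 'cV[R]_m) :
  norm2 (\sum_(i <- s | P i) F i) <= \sum_(i <- s | P i) norm2 (F i).
Proof.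
elim/big_rec2: _ => [|i a x _ le_xa]; first by rewrite norm2_0.
by apply: le_trans (norm2D _ _) _; rewrite lerD2l.
Qed.

(** * The induced norm and the blockwise bound *)

(** Needed for the [sup] in [mxnorm2] to be an upper bound. On the unit ball, [M *m x] combines the
    columns of [M] with coefficients of absolute value at most 1. *)
Lemma norm2_mulmx_ball_bound (R : realType) m n (M : 'M[R]_(m, n)) :
  has_ubound [set norm2 (M *m x) | x in [set x : 'cV[R]_n | norm2 x <= 1]].
Proof.
exists (\sum_(j < n) norm2 (col j M)) => _ [x x1 <-].
have -> : M *m x = \sum_(j < n) x j 0 *: col j M.
  apply/matrixP => i k; rewrite (ord1 k) mxE summxE.
  by apply: eq_bigr => j _; rewrite !mxE mulrC.
apply: le_trans (norm2_sum _ _ _) _; apply: ler_sum => j _.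
by rewrite norm2Z ler_piMl ?norm2_ge0// (le_trans (entry_le_norm2 x j)).
Qed.

(** For [c > 0], scaling by [c^-1] moves [x] into the unit ball; for [c = 0], [x] is zero. *)
Lemma norm2_mulmx_le (R : realType) m n (M : 'M[R]_(m, n)) (x : 'cV[R]_n) c :
  norm2 x <= c -> norm2 (M *m x) <= c * mxnorm2 M.
Proof.
move=> xc; have : 0 <= c := le_trans (norm2_ge0 x) xc.
rewrite le_eqVlt => /predU1P[c0|c_gt0].
  have -> : x = 0 by apply: norm2_eq0; apply/le_anti; rewrite norm2_ge0 c0 xc.
  by rewrite mulmx0 norm2_0 -c0 mul0r.
rewrite -ler_pdivrMl// -(gtr0_norm c_gt0) -normfV -norm2Z scalemxAr.
apply: ub_le_sup; first exact: norm2_mulmx_ball_bound.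
exists (c^-1 *: x) => //=.
by rewrite norm2Z gtr0_norm ?invr_gt0// ler_pdivrMl// mulr1.
Qed.

Lemma norm2_block_row_tvec_le (R : realType) m n l k (X : 'M[R]_(m, n))
    (W : nat -> 'M[R]_(m, n)) (V : nat -> 'M[R]_(m, l)) (dx ew ev : R)
    (x0 : 'cV[R]_n) (w : 'I_k -> 'cV[R]_n) (v : 'I_k.+1 -> 'cV[R]_l) :
  norm2 x0 <= dx -> (forall i, norm2 (w i) <= ew) ->
  (forall j, norm2 (v j) <= ev) ->
  norm2 (block_row k X W V *m tvec x0 w v) <=
    dx * mxnorm2 X + \sum_(i < k) ew * mxnorm2 (W i)
    + \sum_(j < k.+1) ev * mxnorm2 (V j).
Proof.
move=> x0_le w_le v_le.
rewrite /block_row /tvec !mul_row_col !mul_mxrow_mxcol.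
apply: le_trans (norm2D _ _) _; apply: lerD.
  apply: le_trans (norm2D _ _) _; apply: lerD; first exact: norm2_mulmx_le.
  apply: le_trans (norm2_sum _ _ _) _; apply: ler_sum => i _.
  exact: norm2_mulmx_le.
apply: le_trans (norm2_sum _ _ _) _; apply: ler_sum => j _.
exact: norm2_mulmx_le.
Qed.

(** * Vertices of boxes *)

(* Writing coordinate i as a convex combination of b i and - b i and using the
   convexity of the norm, one of these two values does not decrease it. *)
Lemma norm2_mulmx_push (R : realType) m N (M : 'M[R]_(m, N)) (b : R)
    (y : 'cV[R]_N) (i : 'I_N) :
  `|y i 0| <= b ->
  exists c, `|c| = b /\
    norm2 (M *m y) <= norm2 (M *m \col_j (if j == i then c else y j 0)).
Proof.
pose z c : 'cV[R]_N := \col_j (if j == i then c else y j 0).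
move=> yb; have b_ge0 : 0 <= b := le_trans (normr_ge0 _) yb.
move: (yb); rewrite ler_norml => /andP[yl yr].
have hz c : norm2 (M *m y) <= norm2 (M *m z c) -> `|c| = b ->
    exists c, `|c| = b /\ norm2 (M *m y) <= norm2 (M *m z c).
  by exists c.
(* Otherwise both replacements strictly decrease the norm, which is refuted below. *)
have [h|lt1] := leP (norm2 (M *m y)) (norm2 (M *m z b)).
  by apply: (hz b) => //; rewrite ger0_norm.
have [h|lt2] := leP (norm2 (M *m y)) (norm2 (M *m z (- b))).
  by apply: (hz (- b)) => //; rewrite normrN ger0_norm.
have [b0|b_neq0] := eqVneq b 0.
  have y0 : y i 0 = 0 by lra.
  move: lt1; suff -> : z b = y by rewrite ltxx.
  apply/matrixP => j j'; rewrite (ord1 j') mxE.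
  by case: eqP => // ->; rewrite b0 y0.
have b_gt0 : 0 < b by rewrite lt0r b_neq0.
(* The convex combination multiplied by [2 * b], to avoid division. *)
have : norm2 ((2 * b) *: (M *m y)) <=
    norm2 ((b + y i 0) *: (M *m z b)) + norm2 ((b - y i 0) *: (M *m z (- b))).
  have -> : (2 * b) *: (M *m y) =
      (b + y i 0) *: (M *m z b) + (b - y i 0) *: (M *m z (- b)).
    rewrite -!linearZ/= -linearD/=; congr (_ *m _).
    apply/matrixP => j j'; rewrite (ord1 j') !mxE.
    by case: eqP => [->|_]; ring.
  exact: norm2D.
rewrite !norm2Z !ger0_norm; [|lra..].
have h1 : (b + y i 0) * norm2 (M *m z b) <= (b + y i 0) * norm2 (M *m y).
  by apply: ler_wpM2l; [lra|exact: ltW].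
have h2 : (b - y i 0) * norm2 (M *m z (- b)) <= (b - y i 0) * norm2 (M *m y).
  by apply: ler_wpM2l; [lra|exact: ltW].
(* Both weights are nonnegative; the sign of [y i 0] selects one that is surely positive, which
   makes its inequality strict and contradicts the triangle inequality. *)
have [y_ge0|y_lt0] := lerP 0 (y i 0).
  have : (b + y i 0) * norm2 (M *m z b) < (b + y i 0) * norm2 (M *m y).
    by rewrite ltr_pM2l//; lra.
  lra.
have : (b - y i 0) * norm2 (M *m z (- b)) < (b - y i 0) * norm2 (M *m y).
  by rewrite ltr_pM2l//; lra.
lra.
Qed.

(** Coordinates are pushed to the boundary one at a time: after [q] steps the first [q] are
    extremal, and the point still lies in the box, so the next push applies. *)
Lemma norm2_mulmx_corner (R : realType) m N (M : 'M[R]_(m, N)) (b : 'I_N -> R)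
    (x : 'cV[R]_N) :
  (forall i, `|x i 0| <= b i) ->
  exists s : 'cV[R]_N,
    (forall i, `|s i 0| = b i) /\ norm2 (M *m x) <= norm2 (M *m s).
Proof.
move=> xb.
suff /(_ N (leqnn N)) [s [sb sN xs]] : forall q, (q <= N)%N ->
    exists s : 'cV[R]_N, [/\ forall i, `|s i 0| <= b i,
      forall i : 'I_N, (i < q)%N -> `|s i 0| = b i
      & norm2 (M *m x) <= norm2 (M *m s)].
  by exists s; split=> // i; apply: sN.
elim=> [_|q IHq lt_qN]; first by exists x; split.
have [s [sb sq xs]] := IHq (ltnW lt_qN).
have [c [cb sc]] := norm2_mulmx_push M (sb (Ordinal lt_qN)).
exists (\col_j (if j == Ordinal lt_qN then c else s j 0)); split.
- by move=> i; rewrite mxE; case: eqP => [->|_] //; rewrite cb.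
- move=> i; rewrite ltnS leq_eqVlt => iq; rewrite mxE.
  case: eqP => [->|/eqP ni] //; apply: sq.
  by move: iq ni; rewrite -val_eqE/= => /predU1P[->|//]; rewrite eqxx.
- exact: le_trans sc.
Qed.

(** Each [s i 0] is an endpoint of [[- b i, b i]], hence not a proper convex combination of other
    points of that interval. *)
Lemma corner_is_vertex (R : realType) N (b : 'I_N -> R) (s : 'cV[R]_N) :
  (forall i, `|s i 0| = b i) ->
  is_vertex [set x : 'cV[R]_N | forall i, `|x i 0| <= b i] s.
Proof.
move=> sb; split=> [i|y z a yb zb /andP[a_gt0 a_lt1] e]; first by rewrite sb.
suff h i : y i 0 = s i 0 /\ z i 0 = s i 0.
  by split; apply/matrixP => i j; rewrite (ord1 j); case: (h i).
have := yb i; have := zb i; rewrite -sb !ler_norml => /andP[z1 z2] /andP[y1 y2].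
have := congr1 (fun x : 'cV[R]_N => x i 0) e; rewrite !mxE => ei.
by case: (ger0P (s i 0)) z1 z2 y1 y2 => _ *; split; nra.
Qed.

(** [hypercube] is by definition a box with piecewise constant radius, so the corner dominating [x]
    is among the vertices that [t] maximizes over. *)
Lemma max_vertex_ge (R : realType) m n l k (M : 'M[R]_(m, dim_t n l k))
    (dx ew ev : R) (t x : 'cV[R]_(dim_t n l k)) :
  is_max_vertex M (hypercube n l k dx ew ev) t ->
  hypercube n l k dx ew ev x -> norm2 (M *m x) <= norm2 (M *m t).
Proof.
move=> [_ tmax] /(norm2_mulmx_corner M)[s [sb xs]].
exact: le_trans xs (tmax s (corner_is_vertex sb)).
Qed.

Lemma tvec_hypercube (R : realType) n l k (dx ew ev : R)
    (x0 : 'cV[R]_n) (w : 'I_k -> 'cV[R]_n) (v : 'I_k.+1 -> 'cV[R]_l) :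
  norm2 x0 <= dx -> (forall i, norm2 (w i) <= ew) ->
  (forall j, norm2 (v j) <= ev) ->
  hypercube n l k dx ew ev (tvec x0 w v).
Proof.
move=> x0_le w_le v_le i; rewrite /tvec.
(* The [w] blocks fill [n * k] entries, so the [v] blocks start at [n + n * k = n * k.+1], the
   second threshold of [hypercube]. *)
have sum_n : (\sum_(h < k) n = n * k)%N.
  by rewrite sum_nat_const card_ord mulnC.
rewrite -[i]fintype.splitK; case: (fintype.split i) => j; last first.
  rewrite col_mxEd mxE /= sum_n !ifF; [|lia..].
  exact: le_trans (entry_le_norm2 _ _) (v_le _).
rewrite col_mxEu -[j]fintype.splitK; case: (fintype.split j) => j'.
  by rewrite col_mxEu /= ltn_ord; exact: le_trans (entry_le_norm2 _ _) x0_le.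
have j'_lt : (j' < n * k)%N by rewrite -sum_n.
rewrite col_mxEd mxE /=.
rewrite ifF; last by lia.
rewrite mulnS ltn_add2l j'_lt.
exact: le_trans (entry_le_norm2 _ _) (w_le _).
Qed.

Theorem theorem3 (R : realType) (n l p r l2 p2 : nat)
    (A : 'M[R]_n) (C : 'M[R]_(l, n)) (G : 'M[R]_(n, p)) (H : 'M[R]_(l, p))
    (dx0 eta_w eta_v : R)
    (dx0_ge0 : 0 <= dx0) (eta_w_ge0 : 0 <= eta_w) (eta_v_ge0 : 0 <= eta_v)
    (U1 : 'M[R]_(l, r)) (U2 : 'M[R]_(l, l2)) (Sigma : 'M[R]_r)
    (V1 : 'M[R]_(p, r)) (V2 : 'M[R]_(p, p2))
    (svdH : is_svd H U1 U2 Sigma V1 V2) (Sigma_unit : Sigma \in unitmx)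
    (M1 : 'M[R]_r) (M2 : 'M[R]_(p2, l2)) (L : 'M[R]_(n, l2)) :
  let T1 := U1^T in
  let T2 := U2^T in
  let C1 := T1 *m C in
  let C2 := T2 *m C in
  let G1 := G *m V1 in
  let G2 := G *m V2 in
  M1 *m Sigma = 1%:M ->
  M2 *m C2 *m G2 = 1%:M ->
  let Abar := (1%:M - G2 *m M2 *m C2) *m (A - G1 *m M1 *m C1) in
  let Ae := (1%:M - L *m C2) *m Abar in
  let Bsw := 1%:M - G2 *m M2 *m C2 in
  let Bsv1 := - ((1%:M - G2 *m M2 *m C2) *m G1 *m M1 *m T1) in
  let Bsv2 := - (G2 *m M2 *m T2) in
  let Bw := (1%:M - L *m C2) *m Bsw in
  let Bv1 := (1%:M - L *m C2) *m Bsv1 in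
  let Bv2 := (1%:M - L *m C2) *m Bsv2 - L *m T2 in
  forall (k : nat), (2 <= k)%N ->
  let W (i : nat) : 'M[R]_(l2, n) :=
    if i == 0%N then C2 *m Abar *m Ae ^+ (k - 2) *m Bw
    else if (i <= k - 2)%N then C2 *m Abar *m Ae ^+ (k - 1 - i) *m Bw
    else C2 *m Bsw in
  let V (i : nat) : 'M[R]_(l2, l) :=
    if i == 0%N then C2 *m Abar *m Ae ^+ (k - 2) *m Bv1
    else if (i <= k - 2)%N then
      C2 *m Abar *m Ae ^+ (k - 1 - i) *m (Bv1 + Ae *m Bv2)
    else if i == (k - 1)%N then C2 *m (Bsv1 + Abar *m Bv2)
    else C2 *m Bsv2 + T2 in
  let Ak := block_row k (C2 *m Abar *m Ae ^+ (k - 1)) W V in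
  let delta_tri :=
    dx0 * mxnorm2 (C2 *m Abar *m Ae ^+ (k - 1))
    + eta_w * mxnorm2 (C2 *m Abar *m Ae ^+ (k - 2) *m Bw)
    + \sum_(1 <= i < k - 1)
        (eta_w * mxnorm2 (C2 *m Abar *m Ae ^+ i *m Bw)
         + eta_v * mxnorm2 (C2 *m Abar *m Ae ^+ i *m (Bv1 + Ae *m Bv2)))
    + eta_v * (mxnorm2 (C2 *m Abar *m Ae ^+ (k - 2) *m Bv1)
               + mxnorm2 (C2 *m (Bsv1 + Abar *m Bv2))
               + mxnorm2 (C2 *m Bsv2 + T2))
    + eta_w * mxnorm2 (C2 *m Bsw) in
  forall tstar : 'cV[R]_(dim_t n l k),
  is_max_vertex Ak (hypercube n l k dx0 eta_w eta_v) tstar ->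
  let delta_inf := norm2 (Ak *m tstar) in
  let delta_hat := Num.min delta_inf delta_tri in
  delta_r Ak dx0 eta_w eta_v <= delta_hat.

Proof.
move=> T1 T2 C1 C2 G1 G2 _ _ Abar Ae Bsw Bsv1 Bsv2 Bw Bv1 Bv2 k k_ge2 W V Ak
  delta_tri tstar tstarP; cbv zeta.
have [[x0 [w [v [x0_le w_le v_le ->]]]] _] :=
  delta_r_max Ak dx0_ge0 eta_w_ge0 eta_v_ge0.
rewrite le_min; apply/andP; split.
  exact: max_vertex_ge tstarP (tvec_hypercube x0_le w_le v_le).
apply: le_trans (norm2_block_row_tvec_le _ _ _ x0_le w_le v_le) _.
(* The blockwise bound equals [delta_tri] up to the order of the terms. *)
rewrite le_eqVlt; apply/predU1P; left.
case: k k_ge2 @W @V @Ak @delta_tri tstar tstarP w v w_le v_le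
  => [|[|k]] // _ W V Ak delta_tri _ _ _ _ _ _.
(* Here [k] stands for the former [k - 2]. Middle block [i.+1] has exponent
   [k.+2 - 1 - i.+1 = k - i], which runs from [k] down to 1. *)
have WE (i : 'I_k) : W i.+1 = C2 *m Abar *m Ae ^+ (k - i) *m Bw.
  by rewrite /W /= ifT; [congr (_ *m _ ^+ _ *m _)|]; have := ltn_ord i; lia.
have VE (i : 'I_k) :
    V i.+1 = C2 *m Abar *m Ae ^+ (k - i) *m (Bv1 + Ae *m Bv2).
  by rewrite /V /= ifT; [congr (_ *m _ ^+ _ *m _)|]; have := ltn_ord i; lia.
have W0 : W 0%N = C2 *m Abar *m Ae ^+ (k.+2 - 2) *m Bw by [].
have Wlast : W k.+1 = C2 *m Bsw by rewrite /W /= ifF//; lia.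
have V0 : V 0%N = C2 *m Abar *m Ae ^+ (k.+2 - 2) *m Bv1 by [].
have Vk1 : V k.+1 = C2 *m (Bsv1 + Abar *m Bv2).
  by rewrite /V /= ifF ?ifT//; lia.
have Vk2 : V k.+2 = C2 *m Bsv2 + T2 by rewrite /V /= !ifF//; lia.
rewrite big_ord_recl big_ord_recr/= big_ord_recl 2!big_ord_recr/=.
rewrite W0 V0 Wlast Vk1 Vk2.
under eq_bigr => i _ do rewrite WE.
under [X in _ + (_ + (X + _ + _))]eq_bigr => i _ do rewrite VE.
(* Reversing the sum over [1 <= i < k.+1] and shifting it to start at 0 yields the same exponents
   [k - i]. *)
rewrite /delta_tri big_nat_rev/= big_add1 subn1/= big_mkord.
rewrite big_split/=; ring.
Qed.
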